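(* Let $k$ be a countable field. Every countably generated $L$-algebra over $k$ can be embedded into a simple two-generated $L$-algebra over $k$.
   Context: An $L$-algebra over $k$ is a $k$-vector space $L$ with two bilinear operations $\prec,\succ:L\times L\to L$ satisfying $(x\succ y)\prec z=x\succ(y\prec z)$ for all $x,y,z\in L$. Homomorphisms are linear maps preserving both operations; an embedding is an injective homomorphism. An ideal is a subspace $I$ with $a\prec f,\ f\prec a,\ a\succ f,\ f\succ a\in I$ for all $f\in I$, $a\in L$. A (nonzero) $L$-algebra is simple if its only ideals are $0$ and itself. An $L$-algebra is two-generated (countably generated) if it is generated as an $L$-algebra by two elements (by a countable set). Countable means finite or countably infinite. *)

(* Defs.v *)
From HB Require Import structures.
From mathcomp Require Import all_boot all_algebra.
From mathcomp Require Import boolp classical_sets functions cardinality.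

Set Implicit Arguments.
Unset Strict Implicit.
Unset Printing Implicit Defensive.

Import GRing.Theory.
Local Open Scope classical_set_scope.
Local Open Scope ring_scope.

Reserved Notation "x \prec y" (at level 40, left associativity).
Reserved Notation "x \succ y" (at level 40, left associativity).

(* Not to be confused with MathComp's GRing.Lalgebra (left algebras). *)
HB.mixin Record isLAlg (k : fieldType) L & GRing.Lmodule k L := {
  lprec : L -> L -> L;
  lsucc : L -> L -> L;
  lprec_bilinear : bilinear_for *:%R *:%R lprec;
  lsucc_bilinear : bilinear_for *:%R *:%R lsucc;
  lsucc_precA : forall x y z : L,
    lprec (lsucc x y) z = lsucc x (lprec y z)
}.

#[short(type="lAlgType")]
HB.structure Definition LAlg (k : fieldType) :=
  {L of GRing.Lmodule k L & isLAlg k L}.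

Notation "x \prec y" := (lprec x y) : ring_scope.
Notation "x \succ y" := (lsucc x y) : ring_scope.

Section LAlgebras.
Variables (k : fieldType) (L : lAlgType k).

Definition lalg_subspace (S : set L) : Prop := submod_closed [in S].

Definition lalg_subalgebra (S : set L) : Prop :=
  lalg_subspace S /\
  forall x y, S x -> S y -> S (x \prec y) /\ S (x \succ y).

Definition lalg_ideal (I : set L) : Prop :=
  lalg_subspace I /\
  forall a f, I f ->
    [/\ I (a \prec f), I (f \prec a), I (a \succ f) & I (f \succ a)].

Definition lalg_simple : Prop :=
  [set: L] <> [set 0] /\
  forall I : set L, lalg_ideal I -> I = [set 0] \/ I = [set: L].

Definition lalg_generated_by (X : set L) : Prop :=
  smallest lalg_subalgebra X = [set: L].

Definition lalg_countably_generated : Prop :=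
  exists X : set L, countable X /\ lalg_generated_by X.

(* The generators x and y may coincide. *)
Definition lalg_two_generated : Prop :=
  exists x y : L, lalg_generated_by [set x; y].

End LAlgebras.

Arguments lalg_simple {k} L.
Arguments lalg_countably_generated {k} L.
Arguments lalg_two_generated {k} L.

Definition lalg_hom (k : fieldType) (A B : lAlgType k) (f : A -> B) : Prop :=
  [/\ linear f, {morph f : x y / x \prec y} & {morph f : x y / x \succ y}].

Definition lalg_embedding (k : fieldType) (A B : lAlgType k) (f : A -> B) :
  Prop := lalg_hom f /\ injective f.

(* Main.v *)
Require Import Defs.
From HB Require Import structures.
From mathcomp Require Import all_boot all_algebra.
From mathcomp Require Import boolp classical_sets functions cardinality.

Set Implicit Arguments.
Unset Strict Implicit.
Unset Printing Implicit Defensive.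

Import GRing.Theory.
Local Open Scope classical_set_scope.
Local Open Scope ring_scope.

(** Write [lambda x] for the operator x \succ _ and [rho z] for _ \prec z.  The
    single identity of L-algebras says that every [lambda x] commutes with every
    [rho z]; so an L-algebra is a vector space with two linear families of
    operators whose images commute, and nothing ties an operator to the element
    that indexes it.  That freedom is what the proof exploits.

    Let A be a nonzero countable L-algebra and let R be the unital algebra of
    operators on A generated by the [rho a] ([rop A]).  Let M be the direct sum
    of A and of a free R-module with countably many generators w_0, w_1, ...
    ([hull_space], [act]).  Make [rho z] act on M
    through the A-component of z only, by the R-action.  The operators commuting
    with all the [rho z] then contain the R-linear ones, and on the free part
    these are given by arbitrary images of the w_i.  Hence for any sequence of
    linear maps theta_i : M -> M there is an L-algebra structure on M containing
    A in which f \succ w_i = theta_i f for all f in M ([hull], [succ_hgen],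
    [hull_in_embedding]).

    Since k and A are countable, so are R and M; let e_0, e_1, ... list M.
    Choose the theta_i as follows ([steering]).
    - theta_0 sends w_j to w_(j+1).  Then w_(j+1) = w_j \succ w_0, so w_0
      generates all the w_j.
    - theta_1 sends w_j to e_j.  Then e_j = w_j \succ w_1, so w_0 generates M
      ([steering_generated]).
    - theta_(n+2) g = phi_n(g) w_0 with phi_n a linear functional equal to 1 at
      e_n when e_n is nonzero ([functional_separating]).  An ideal containing
      e_n <> 0 then contains e_n \succ w_(n+2) = w_0, so it is everything
      ([steering_simple]).

    Countably generated algebras over a countable field are countable
    ([countably_generated_countable]).  The algebra A = 0, for which M would
    vanish, maps to any simple algebra produced from a nonzero A. *)

(** * Countable sets *)

Lemma countable_setU (T : Type) (C D : set T) :
  countable C -> countable D -> countable (C `|` D).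
Proof.
by move=> cC cD; rewrite -bigcup2E; apply: bigcup_countable => // -[|[|i]].
Qed.

Lemma countable_set1U (T : Type) (x : T) (D : set T) :
  countable D -> countable ([set x] `|` D).
Proof. exact: countable_setU. Qed.

Lemma countable_range (S T : Type) (g : S -> T) :
  countable [set: S] -> countable (range g).
Proof. exact: sub_countable (card_image_le _ _). Qed.

(** The closure is reached in countably many steps, each applying the operations
    once to what has been built so far. *)
Lemma countable_closure (T : Type) (X : set T) (Ops : set (T -> T -> T)) :
    countable X -> countable Ops ->
  exists C : set T, [/\ countable C, X `<=` C &
    forall op x y, Ops op -> C x -> C y -> C (op x y)].
Proof.
move=> cX cOps.
pose step S := [set q.1 q.2.1 q.2.2 | q in Ops `*` (S `*` S)].
pose C_ n := iter n (fun S => S `|` step S) X.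
have leC m n : (m <= n)%N -> C_ m `<=` C_ n.
  move=> /subnK <-; elim: (n - m)%N => [|d IHd] // x /IHd.
  by rewrite addSn /C_ iterS; left.
exists (\bigcup_n C_ n); split.
- apply: bigcup_countable => // n _; elim: n => [|n IHn] //.
  rewrite /C_ iterS -/(C_ n); apply: countable_setU => //.
  apply: sub_countable (card_image_le _ _) _.
  by apply: countableX => //; apply: countableX.
- by move=> x Xx; exists 0%N.
- move=> op x y Oop [m _ Cx] [n _ Cy].
  exists (maxn m n).+1 => //; rewrite /C_ iterS; right.
  exists (op, (x, y)) => //; split=> //; split=> /=.
  + exact: leC (leq_maxl _ _) _ Cx.
  + exact: leC (leq_maxr _ _) _ Cy.
Qed.

Lemma countable_enum (T : choiceType) (x0 : T) :
  countable [set: T] -> exists e : nat -> T, forall x, exists n, e n = x.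
Proof.
move=> /countable_injP[g g_inj].
exists (fun n => xget x0 [set x | g x = n]) => x; exists (g x).
case: xgetP => [y _ gyx|/(_ x)[]//].
by apply: g_inj; rewrite ?in_setT.
Qed.

(** * Linear functionals *)

(** By Zorn, some subset closed under the combinations c x + y is maximal among
    those missing f.  It is a complement of the line k f, and phi is the
    coordinate along f. *)
Lemma functional_separating (k : fieldType) (V : lmodType k) (f : V) :
  f != 0 -> exists phi : {scalar V}, phi f = 1.
Proof.
move=> f0.
pose P (H : set V) :=
  (forall c x y, H x -> H y -> H (c *: x + y)) /\ ~ H f.
have [|H [[Hlin Hf] Hmax]] := @Zorn_bigcup V P.
  move=> F FP Ftot; split=> [c x y [X FX Xx] [Y FY Yy]|[X FX]]; last first.
    by have [_] := FP _ FX.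
  have [XY|YX] := Ftot _ _ FX FY.
    by exists Y => //; have [+ _] := FP _ FY; apply => //; apply: XY.
  by exists X => //; have [+ _] := FP _ FX; apply => //; apply: YX.
have H0 : H 0.
  (* Only the empty candidate misses 0, and [set 0] is a larger one. *)
  apply: contrapT => nH0; apply: (Hmax [set 0]).
    split; last by move=> /(_ 0 erefl).
    move=> x Hx; exfalso; apply: nH0.
    by have := Hlin (-1) x x Hx Hx; rewrite scaleN1r addNr.
  split=> [c x y -> ->|/eqP]; first by rewrite scaler0 addr0.
  by rewrite (negbTE f0).
have HZ c x : H x -> H (c *: x).
  by move=> Hx; rewrite -[_ *: _]addr0; apply: Hlin.
have coord g : exists c, H (g - c *: f).
  have [Hg|nHg] := pselect (H g); first by exists 0; rewrite scale0r subr0.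
  (* By maximality the span H' of H and g contains f. *)
  pose H' := [set x | exists c, H (x - c *: g)].
  have [c Hc] : H' f.
    apply: contrapT => nH'f; apply: (Hmax H'); last first.
      split=> // a x y [c Hc] [d Hd]; exists (a * c + d).
      rewrite scalerDl -scalerA opprD addrACA -scalerBr; exact: Hlin.
    split=> [x Hx|/(_ g)]; first by exists 0; rewrite scale0r subr0.
    by move=> HH'; apply/nHg/HH'; exists 1; rewrite scale1r subrr.
  have c0 : c != 0.
    by apply: contra_notN Hf => /eqP c0; rewrite c0 scale0r subr0 in Hc.
  exists c^-1; have := HZ (- c^-1) _ Hc.
  by rewrite scalerBr scalerA mulNr mulVf // scaleN1r opprK scaleNr addrC.
have [phi phiP] := choice coord.
have coord_inj c d g : H (g - c *: f) -> H (g - d *: f) -> c = d.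
  move=> Hc Hd; apply/eqP; rewrite -subr_eq0; apply: contra_notT Hf => cd0.
  have := HZ (c - d)^-1 _ (Hlin (-1) _ _ Hc Hd).
  rewrite scaleN1r opprB addrA subrK -scalerBl scalerA mulVf //.
  by rewrite scale1r.
have phi_lin : scalar phi.
  move=> a x y; apply: coord_inj (phiP _) _.
  rewrite scalerDl -scalerA opprD addrACA -scalerBr.
  by apply: Hlin; apply: phiP.
pose phiL := GRing.isLinear.Build k V k *%R phi phi_lin.
exists (HB.pack phi phiL : {scalar V}).
by apply: coord_inj (phiP f) _; rewrite scale1r subrr.
Qed.

Lemma linear_at0 (k : fieldType) (U V : lmodType k) (f : U -> V) :
  linear f -> f 0 = 0.
Proof. by move=> /(_ (-1) 0 0); rewrite /= !scaleN1r !addNr. Qed.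

(** * Finitely supported sequences *)

Section FiniteSequences.
Variables (k : fieldType) (V : lmodType k).

Definition finsupp_seq : {pred nat -> V} :=
  fun s => `[< exists n, forall i, (n <= i)%N -> s i = 0 >].

Fact finsupp_seq_closed : submod_closed finsupp_seq.
Proof.
split=> [|c s t]; first by apply/asboolP; exists 0%N.
move=> /asboolP[m sm] /asboolP[n tn]; apply/asboolP; exists (maxn m n) => i.
rewrite geq_max => /andP[mi ni].
by rewrite !fctE sm // tn // scaler0 addr0.
Qed.

HB.instance Definition _ :=
  GRing.isSubmodClosed.Build k (nat -> V) finsupp_seq finsupp_seq_closed.

Record fseq := FSeq { fseq_val :> nat -> V; _ : fseq_val \in finsupp_seq }.

HB.instance Definition _ := [isSub for fseq_val].
HB.instance Definition _ := [Choice of fseq by <:].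
HB.instance Definition _ := [SubChoice_isSubLmodule of fseq by <:].

Lemma fseqP (s t : fseq) : (forall i, s i = t i) -> s = t.
Proof. by move=> st; apply/val_inj/funext. Qed.

Lemma fseqD (s t : fseq) i : (s + t) i = s i + t i.
Proof. by []. Qed.

Lemma fseqZ c (s : fseq) i : (c *: s) i = c *: s i.
Proof. by []. Qed.

Lemma fseq_bound (s : fseq) : exists n, forall i, (n <= i)%N -> s i = 0.
Proof. by case: s => s /= /asboolP. Qed.

(** Any bound on the support will do: by [fsum_bound] the sums below do not
    depend on the choice. *)
Definition fwidth (s : fseq) : nat := projT1 (cid (fseq_bound s)).

Lemma fwidthP (s : fseq) i : (fwidth s <= i)%N -> s i = 0.
Proof. by rewrite /fwidth; case: cid => n /= /(_ i). Qed.

Definition fsum (U : lmodType k) (F : nat -> V -> U) (s : fseq) : U :=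
  \sum_(i < fwidth s) F i (s i).

Lemma fsum_bound (U : lmodType k) (F : nat -> V -> U) (s : fseq) n :
  (forall i, F i 0 = 0) -> (forall i, (n <= i)%N -> s i = 0) ->
  fsum F s = \sum_(i < n) F i (s i).
Proof.
move=> F0 sn.
(* Any two bounds compare through their maximum. *)
have widen m : (forall i, (m <= i)%N -> s i = 0) ->
    \sum_(i < m) F i (s i) = \sum_(i < maxn m n) F i (s i).
  move=> sm.
  rewrite (big_ord_widen (maxn m n) (fun i => F i (s i))) ?leq_maxl //.
  rewrite [RHS](bigID (fun i : 'I__ => (i < m)%N)) /=.
  rewrite [X in _ + X]big1 ?addr0 // => i.
  by rewrite -leqNgt => /sm ->.
rewrite /fsum (widen _ (@fwidthP s)).
rewrite (big_ord_widen (maxn (fwidth s) n) (fun i => F i (s i)) (leq_maxr _ _)).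
rewrite (bigID (fun i : 'I__ => (i < n)%N)) /= [X in _ + X]big1 ?addr0 // => i.
by rewrite -leqNgt => /sn ->.
Qed.

Lemma fsum_linear (U : lmodType k) (F : nat -> V -> U) :
  (forall i, linear (F i)) -> linear (fsum F).
Proof.
move=> Flin c s t.
have F0 i : F i 0 = 0 by exact: linear_at0.
pose n := maxn (fwidth s) (fwidth t).
have [sn tn] : (forall i, (n <= i)%N -> s i = 0) /\
               (forall i, (n <= i)%N -> t i = 0).
  by split=> i; rewrite geq_max => /andP[? ?]; apply: fwidthP.
rewrite !(fsum_bound (n := n)) //; last first.
  by move=> i ni; rewrite fseqD fseqZ sn // tn // scaler0 addr0.
rewrite scaler_sumr -big_split /=; apply: eq_bigr => i _.
exact: Flin.
Qed.

Definition fsingle_fun (i : nat) (v : V) (j : nat) : V :=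
  if j == i then v else 0.

Fact fsingle_subproof i v : fsingle_fun i v \in finsupp_seq.
Proof.
apply/asboolP; exists i.+1 => j ij; rewrite /fsingle_fun.
by case: eqP ij => // ->; rewrite ltnn.
Qed.

Definition fsingle i v : fseq := FSeq (fsingle_subproof i v).

Lemma fsum_single (U : lmodType k) (F : nat -> V -> U) i v :
  (forall j, F j 0 = 0) -> fsum F (fsingle i v) = F i v.
Proof.
move=> F0; rewrite (fsum_bound (n := i.+1)) //; last first.
  move=> j ij; rewrite /= /fsingle_fun.
  by case: eqP ij => // ->; rewrite ltnn.
rewrite big_ord_recr /= /fsingle_fun eqxx big1 ?add0r // => j _.
by rewrite ltn_eqF.
Qed.

Definition fshift_fun (s : nat -> V) (j : nat) : V :=
  if j is j'.+1 then s j' else 0.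

Fact fshift_subproof (s : fseq) : fshift_fun s \in finsupp_seq.
Proof.
by apply/asboolP; exists (fwidth s).+1 => -[|j] // /fwidthP.
Qed.

Definition fshift s : fseq := FSeq (fshift_subproof s).

Lemma fshift_linear : linear fshift.
Proof.
by move=> c s t; apply: fseqP => -[|j]; rewrite fseqD fseqZ //= scaler0 addr0.
Qed.

Lemma fshift_single i v : fshift (fsingle i v) = fsingle i.+1 v.
Proof. by apply: fseqP => -[|j]. Qed.

(** A sequence is determined by the list of its first [fwidth s] terms: the
    length of that list recovers the width, beyond which all terms vanish. *)
Lemma countable_fseq : countable [set: V] -> countable [set: fseq].
Proof.
move=> /countable_injP[g g_inj]; apply/countable_injP.
pose code (s : fseq) := pickle [seq g (s i) | i <- iota 0 (fwidth s)].
exists code => s t _ _ /(pcan_inj pickleK) st.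
have wst : fwidth s = fwidth t.
  by have := congr1 size st; rewrite !size_map !size_iota.
apply: fseqP => i; have [iw|wi] := ltnP i (fwidth s); last first.
  by rewrite !fwidthP // -wst.
have := congr1 (fun l => nth 0%N l i) st.
rewrite -wst !(nth_map 0%N) ?size_iota // nth_iota // add0n.
by apply: g_inj; rewrite in_setT.
Qed.

End FiniteSequences.

Section Map.
Variables (k : fieldType) (V W : lmodType k) (g : {linear V -> W}).

Fact fmap_subproof (s : fseq V) : g \o s \in @finsupp_seq k W.
Proof.
by apply/asboolP; exists (fwidth s) => i /fwidthP /= ->; rewrite linear0.
Qed.

Definition fmap s : fseq W := FSeq (fmap_subproof s).

Lemma fmap_linear : linear fmap.
Proof. by move=> c s t; apply: fseqP => i; rewrite fseqD fseqZ /= linearP. Qed.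

End Map.

(** * The operator algebra of right multiplications *)

Section RightOperators.
Variables (k : fieldType) (A : lAlgType k).

(** A free module whose generators can be sent to any element of A needs scalars
    that act on A and include all right multiplications.  The operators these
    generate serve, and are countable when A and k are. *)
Inductive right_operator : (A -> A) -> Prop :=
| RightId : right_operator id
| RightPrec a : right_operator (fun x => x \prec a)
| RightLin c r s : right_operator r -> right_operator s ->
    right_operator (c *: r + s)
| RightComp r s : right_operator r -> right_operator s ->
    right_operator (r \o s).

Lemma right_operator_linear r : right_operator r -> linear r.
Proof.
elim=> [|a|c {}r s _ IHr _ IHs|{}r s _ IHr _ IHs] d x y //=.
- exact: (lprec_bilinear.1 a).
- rewrite !fctE IHr IHs !scalerDr !scalerA (mulrC d c) !addrA.
  by congr (_ + _); rewrite -!addrA; congr (_ + _); rewrite addrC.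
- by rewrite IHs IHr.
Qed.

Definition rop_pred : {pred A -> A} := fun r => `[< right_operator r >].

Fact rop_closed : submod_closed rop_pred.
Proof.
have lin c r s : r \in rop_pred -> s \in rop_pred -> c *: r + s \in rop_pred.
  by move=> /asboolP ? /asboolP ?; apply/asboolP; exact: RightLin.
split=> // ; rewrite -(addNr (id : A -> A)) -scaleN1r.
by apply: lin; apply/asboolP; exact: RightId.
Qed.

HB.instance Definition _ :=
  GRing.isSubmodClosed.Build k (A -> A) rop_pred rop_closed.

Record rop := Rop { rop_val :> A -> A; _ : rop_val \in rop_pred }.

HB.instance Definition _ := [isSub for rop_val].
HB.instance Definition _ := [Choice of rop by <:].
HB.instance Definition _ := [SubChoice_isSubLmodule of rop by <:].

Lemma ropP (r : rop) : right_operator r.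
Proof. by case: r => r /= /asboolP. Qed.

Lemma rop_linear (r : rop) : linear r.
Proof. exact/right_operator_linear/ropP. Qed.

Lemma rop_eq (r s : rop) : (forall x, r x = s x) -> r = s.
Proof. by move=> rs; apply/val_inj/funext. Qed.

Definition rop1 : rop := Rop (asboolT RightId).

Definition rprec (a : A) : rop := Rop (asboolT (RightPrec a)).

Definition rcomp (r s : rop) : rop :=
  Rop (asboolT (RightComp (ropP r) (ropP s))).

Lemma rprec_linear : linear rprec.
Proof.
by move=> c a b; apply: rop_eq => x /=; rewrite (lprec_bilinear.2 x).
Qed.

Lemma rcomp_linearl s : linear (rcomp^~ s).
Proof. by move=> c r r'; apply: rop_eq. Qed.

Lemma rcomp_linearr r : linear (rcomp r).
Proof. by move=> c s s'; apply: rop_eq => x /=; exact: rop_linear. Qed.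

HB.instance Definition _ r :=
  GRing.isLinear.Build k rop rop *:%R (rcomp r) (rcomp_linearr r).

End RightOperators.

(** * Hulls: prescribing the products with the free generators *)

Section Hull.
Variables (k : fieldType) (A : lAlgType k).

(** The direct sum of A and of the free module over [rop A] on generators
    indexed by nat; the sequence s stands for the sum of the s_i w_i. *)
Definition hull_space : lmodType k := (A * fseq (rop A))%type.
Local Notation M := hull_space.

Definition act (r : rop A) (m : M) : M := (r m.1, fmap (rcomp r) m.2).

Lemma act_linearr r : linear (act r).
Proof.
move=> c m n; rewrite /act /= rop_linear.
by congr pair; apply: fmap_linear.
Qed.

Lemma act_linearl m : linear (act^~ m).
Proof.
move=> c r s; congr pair; apply: fseqP => i.
by rewrite fseqD fseqZ /= rcomp_linearl.
Qed.

Lemma act_comp r s m : act (rcomp r s) m = act r (act s m).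
Proof. by congr pair; apply: fseqP => i; apply: rop_eq. Qed.

Lemma act1 m : act (rop1 A) m = m.
Proof. by case: m => a s; congr pair; apply: fseqP => i; apply: rop_eq. Qed.

HB.instance Definition _ r :=
  GRing.isLinear.Build k M M *:%R (act r) (act_linearr r).

(** The R-linear map from the free module to M that sends w_i to [e i]. *)
Definition fcomb (e : nat -> M) : fseq (rop A) -> M :=
  fsum (fun i r => act r (e i)).

Lemma fcomb_linear e : linear (fcomb e).
Proof. by apply: fsum_linear => i; exact: act_linearl. Qed.

(** The R-linearity of [fcomb e] is the source of the L-algebra identity. *)
Lemma act_fcomb e r s : act r (fcomb e s) = fcomb e (fmap (rcomp r) s).
Proof.
rewrite /fcomb [RHS](fsum_bound (n := fwidth s)); last first.
- by move=> i /fwidthP /= ->; rewrite linear0.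
- by move=> i; exact: (linear_at0 (act_linearl _)).
by rewrite linear_sum; apply: eq_bigr => i _; exact: (esym (act_comp _ _ _)).
Qed.

Lemma fcomb_single e i r : fcomb e (fsingle i r) = act r (e i).
Proof.
by apply: fsum_single => j; exact: (linear_at0 (act_linearl _)).
Qed.

Lemma base_linear : linear (fun a : A => (a, 0) : M).
Proof.
move=> c a b; congr pair; apply: fseqP => i.
by rewrite fseqD fseqZ scaler0 addr0.
Qed.

Definition hgen (i : nat) : M := (0, fsingle i (rop1 A)).

(** An alias of [hull_space], indexed by [theta] so that each choice of
    prescribed products carries its own L-algebra structure. *)
Definition hull (theta : nat -> {linear M -> M}) : Type := M.

Section HullAlgebra.
Variable theta : nat -> {linear M -> M}.
Local Notation H := (hull theta).

HB.instance Definition _ := GRing.Lmodule.on H.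

Definition hull_prec (m z : H) : H := act (rprec z.1) m.

(** On A this is the given product; on the free part it is the R-linear operator
    sending w_i to [theta i f].  Both commute with [act (rprec z.1)], whatever
    [theta] is. *)
Definition hull_succ (f m : H) : H :=
  ((f.1 \succ m.1, 0) : M) + fcomb (fun i => theta i f) m.2.

Fact hull_prec_bilinear : bilinear_for *:%R *:%R hull_prec.
Proof.
split=> [z|m] c x y; first exact: act_linearr.
by rewrite /hull_prec rprec_linear; exact: act_linearl.
Qed.

Fact hull_succ_bilinear : bilinear_for *:%R *:%R hull_succ.
Proof.
have dist c (p p' q q' : M) : c *: p + p' + (c *: q + q') =
    c *: (p + q) + (p' + q') by rewrite scalerDr addrACA.
split=> [m|f] c x y; rewrite /hull_succ -dist.
- congr (_ + _).
    by rewrite -base_linear -(lsucc_bilinear.1 m.1).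
  rewrite /fcomb /fsum scaler_sumr -big_split; apply: eq_bigr => i _ /=.
  by rewrite !linearP.
- congr (_ + _); last exact: fcomb_linear.
  by rewrite -base_linear -(lsucc_bilinear.2 f.1).
Qed.

Fact hull_lsucc_precA (x y z : H) :
  hull_prec (hull_succ x y) z = hull_succ x (hull_prec y z).
Proof.
rewrite /hull_prec /hull_succ linearD /= act_fcomb; congr (_ + _).
congr pair; first exact: lsucc_precA.
by apply: fseqP => i; exact: (linear0 (rcomp (rprec z.1))).
Qed.

HB.instance Definition _ := isLAlg.Build k H
  hull_prec_bilinear hull_succ_bilinear hull_lsucc_precA.

Definition hull_in (a : A) : H := (a, 0).

Lemma hull_in_embedding : lalg_embedding hull_in.
Proof.
split; last by move=> a b [].
split=> [|a b|a b]; first exact: base_linear.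
- by congr pair; apply: fseqP => i; exact: esym (linear0 (rcomp (rprec b))).
- rewrite -[RHS]/(hull_succ _ _) /hull_succ /=.
  by rewrite (linear_at0 (@fcomb_linear _)) addr0.
Qed.

(** The reason for hulls: the products with the generators can be prescribed
    freely. *)
Lemma succ_hgen (f : H) i : f \succ (hgen i : H) = theta i f.
Proof.
rewrite -[LHS]/(hull_succ _ _) /hull_succ /= fcomb_single act1.
have -> : f.1 \succ 0 = 0.
  exact: (linear_at0 (lsucc_bilinear.2 f.1)).
exact: add0r.
Qed.

End HullAlgebra.

(** * Countability of hulls *)

Lemma countable_rop :
  countable [set: k] -> countable [set: A] -> countable [set: rop A].
Proof.
move=> ck cA.
pose X := [set (id : A -> A)] `|` range (fun a : A => lprec^~ a).
pose Ops := [set (fun r s : A -> A => r \o s)] `|`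
  range (fun (c : k) (r s : A -> A) => c *: r + s).
have [C [cC XC Cop]] : exists C, [/\ countable C, X `<=` C &
    forall op r s, Ops op -> C r -> C s -> C (op r s)].
  by apply: countable_closure; apply: countable_set1U; exact: countable_range.
have sub_C r : right_operator r -> C r.
  elim=> [|a|c {}r s _ Cr _ Cs|{}r s _ Cr _ Cs].
  - by apply: XC; left.
  - by apply: XC; right; exists a.
  - by apply: (Cop (fun r s => c *: r + s)) => //; right; exists c.
  - by apply: (Cop (fun r s => r \o s)) => //; left.
move: cC => /countable_injP[g g_inj]; apply/countable_injP.
exists (fun r => g r) => r s _ _ grs; apply/val_inj/g_inj => //.
all: by rewrite inE; apply/sub_C/ropP.
Qed.

Lemma countable_hull_space :
  countable [set: k] -> countable [set: A] -> countable [set: M].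
Proof.
move=> ck cA; rewrite -setXTT; apply: countableX => //.
exact/countable_fseq/countable_rop.
Qed.

(** * Simple and two-generated hulls *)

Definition gen_shift (f : M) : M := (0, fshift f.2).

Fact gen_shift_linear : linear gen_shift.
Proof.
move=> c f g; congr pair; last exact: fshift_linear.
by rewrite -[RHS]/(c *: 0 + 0) scaler0 addr0.
Qed.

HB.instance Definition _ :=
  GRing.isLinear.Build k M M *:%R gen_shift gen_shift_linear.

Definition gen_subst (e : nat -> M) (f : M) : M := fcomb e f.2.

Fact gen_subst_linear e : linear (gen_subst e).
Proof. by move=> c f g; exact: fcomb_linear. Qed.

HB.instance Definition _ e :=
  GRing.isLinear.Build k M M *:%R (gen_subst e) (gen_subst_linear e).

Definition steer_to_gen0 (phi : {scalar M}) (f : M) : M := phi f *: hgen 0.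

Fact steer_to_gen0_linear phi : linear (steer_to_gen0 phi).
Proof. by move=> c f g; rewrite /steer_to_gen0 linearP scalerDl scalerA. Qed.

HB.instance Definition _ phi :=
  GRing.isLinear.Build k M M *:%R (steer_to_gen0 phi)
    (steer_to_gen0_linear phi).

Definition steering (e : nat -> M) (phi : nat -> {scalar M}) (i : nat) :
    {linear M -> M} :=
  match i with
  | 0 => gen_shift
  | 1 => gen_subst e
  | j.+2 => steer_to_gen0 (phi j)
  end.

Section Steering.
Variables (e : nat -> M) (phi : nat -> {scalar M}).
Hypothesis e_surj : forall m, exists n, e n = m.
Hypothesis phi_e : forall n, e n != 0 -> phi n (e n) = 1.
Local Notation H := (hull (steering e phi)).

(** From w_0, the products w_j \succ w_0 = w_(j+1) give every generator, and the
    products w_j \succ w_1 = e_j then give every element. *)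
Lemma steering_generated (S : set H) :
  lalg_subalgebra S -> S (hgen 0) -> S = [set: H].
Proof.
move=> [_ Sop] S0.
have Sgen i : S (hgen i).
  elim: i => [|i Si] //; have [_] := Sop _ _ Si S0.
  by rewrite (succ_hgen _ 0) /= /gen_shift /= fshift_single.
apply/seteqP; split=> // m _; have [n <-] := e_surj m.
have [_] := Sop _ _ (Sgen n) (Sgen 1%N).
by rewrite succ_hgen /= /gen_subst fcomb_single act1.
Qed.

Lemma steering_two_generated : lalg_two_generated H.
Proof.
exists (hgen 0), (hgen 0); apply/seteqP; split=> // m _.
by move=> S [Ssub S0]; rewrite (steering_generated Ssub) //; apply: S0; left.
Qed.

(** A nonzero element e_n of an ideal yields w_0 = e_n \succ w_(n+2), and an
    ideal is in particular a subalgebra. *)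
Lemma steering_simple (a : A) : a != 0 -> lalg_simple H.
Proof.
move=> a0; split.
  have Ha : [set: H] (hull_in _ a) by [].
  by move=> HE; move: Ha; rewrite HE => -[/eqP]; rewrite (negbTE a0).
move=> I [Isub Iop]; have [I0|] := pselect (I `<=` [set 0]).
  by left; apply/seteqP; split=> // x ->; have [] := Isub; rewrite inE.
move=> /existsNP[f /not_implyP[If /eqP f0]]; right.
have [n fE] := e_surj f; subst f.
apply: steering_generated.
  by split=> // x y Ix Iy; have [? ? ? ?] := Iop y _ Ix.
have [_ _ _] := Iop (hgen n.+2) _ If.
by rewrite succ_hgen /= /steer_to_gen0 phi_e // scale1r.
Qed.

End Steering.

Lemma hull_simple_two_generated (a : A) : a != 0 -> countable [set: M] ->
  exists theta, lalg_simple (hull theta) /\ lalg_two_generated (hull theta).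
Proof.
move=> a0 /countable_enum-/(_ 0)[e e_surj].
have /choice[phi phi_e] n :
    exists phi : {scalar M}, e n != 0 -> phi (e n) = 1.
  have [->|/functional_separating[phi phi1]] := eqVneq (e n) 0.
    (* Here any functional does. *)
    have /functional_separating[phi _] : ((a, 0) : M) != 0.
      by apply: contra_neq a0 => -[].
    by exists phi.
  by exists phi.
exists (steering e phi); split.
- exact: steering_simple a0.
- exact: steering_two_generated.
Qed.

End Hull.

(** * The embedding theorem *)

Section CountablyGenerated.
Variables (k : fieldType) (A : lAlgType k).

Lemma countably_generated_countable :
  countable [set: k] -> lalg_countably_generated A -> countable [set: A].
Proof.
move=> ck [X [cX genX]].
pose Ops := [set (@lprec k A)] `|` ([set (@lsucc k A)] `|`
  range (fun (c : k) (x y : A) => c *: x + y)).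
have [C [cC XC Cop]] : exists C, [/\ countable C, [set 0] `|` X `<=` C &
    forall op r s, Ops op -> C r -> C s -> C (op r s)].
  apply: countable_closure; first exact: countable_set1U.
  by do 2!apply: countable_set1U; exact: countable_range.
suff <- : C = [set: A] by [].
apply/seteqP; split=> // x _.
have : smallest (@lalg_subalgebra k A) X x by rewrite genX.
apply; split; last by move=> y Xy; apply: XC; right.
split; first split; rewrite ?inE.
- by apply: XC; left.
- move=> c y z; rewrite !inE => Cy Cz.
  by apply: (Cop (fun y z => c *: y + z)) => //; right; right; exists c.
- move=> y z Cy Cz; split; apply: Cop => //; first by left.
  by right; left.
Qed.

End CountablyGenerated.

Section ZeroAlgebra.
Variable k : fieldType.

(** A one-dimensional algebra with zero products, a nonzero substitute for the
    trivial algebra. *)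
Definition zero_line : Type := k^o.
HB.instance Definition _ := GRing.Lmodule.on zero_line.

Definition zero_op (x y : zero_line) : zero_line := 0.

Fact zero_op_bilinear : bilinear_for *:%R *:%R zero_op.
Proof. by split=> u c x y; rewrite /zero_op /= scaler0 addr0. Qed.

Fact zero_op_precA x y z : zero_op (zero_op x y) z = zero_op x (zero_op y z).
Proof. by []. Qed.

HB.instance Definition _ := isLAlg.Build k zero_line
  zero_op_bilinear zero_op_bilinear zero_op_precA.

End ZeroAlgebra.

Lemma embedding_of_countable (k : fieldType) (A : lAlgType k) (a : A) :
    countable [set: k] -> countable [set: A] -> a != 0 ->
  exists (B : lAlgType k) (f : A -> B),
    [/\ lalg_simple B, lalg_two_generated B & lalg_embedding f].
Proof.
move=> ck cA a0.
have [theta [simB genB]] :=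
  hull_simple_two_generated a0 (countable_hull_space ck cA).
exists (hull theta), (@hull_in _ _ theta); split=> //.
exact: hull_in_embedding.
Qed.

Theorem theorem5p10 (k : fieldType) (k_countable : countable [set: k])
    (A : lAlgType k) (A_countably_generated : lalg_countably_generated A) :
  exists (B : lAlgType k) (f : A -> B),
    [/\ lalg_simple B, lalg_two_generated B & lalg_embedding f].
Proof.
have cA := countably_generated_countable k_countable A_countably_generated.
have [[a /eqP a0]|/forallNP A0] := pselect (exists a : A, a <> 0).
  exact: embedding_of_countable k_countable cA a0.
have Aa0 (a : A) : a = 0 by apply: contrapT; exact: A0.
have [B [_ [simB genB _]]] := @embedding_of_countable k (zero_line k) 1
  k_countable k_countable (oner_neq0 k).
exists B, (fun=> 0); split=> //.
split; last by move=> a b _; rewrite (Aa0 a) (Aa0 b).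
split=> [c a b|a b|a b]; first by rewrite scaler0 addr0.
- by rewrite (linear_at0 (lprec_bilinear.2 0)).
- by rewrite (linear_at0 (lsucc_bilinear.2 0)).
Qed.
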